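(* Let $k\le r\le n$. Suppose $(R,y)\in\mathbb{R}^{(n-k)\times r}\times\mathbb{R}^p$, put $\widehat R=[I_{k,r};R]\in\mathbb{R}^{n\times r}$, $C=\nabla_X\phi(\widehat R\widehat R^\top,y\circ y)$, $c=\nabla_x\phi(\widehat R\widehat R^\top,y\circ y)$, and suppose there exists $\lambda\in\mathbb{R}^m$ satisfying the following conditions: (i) $\mathcal{K}(\widehat R\widehat R^\top,y\circ y)=b$; (ii) $J_{n-k,n}\,(C-\mathcal{A}^*(\lambda))\,\widehat R=0$ and $(c-B^\top\lambda)\circ y=0$; (iii) $C_{22}-\tilde{\mathcal{A}}^*(\lambda)\in\mathbb{S}^{n-k}_+$ and $c-B^\top\lambda\in\mathbb{R}^p_+$. Then $(\widehat R\widehat R^\top,\,y\circ y,\,\lambda,\,\Lambda)$ is a KKT solution of (SDP), where $$\Lambda:=C_{11}+I_{k,r}R^\top J_{n-k,n}\,(C-\mathcal{A}^*(\lambda))\,I_{n,k}-I_{n,k}^\top\mathcal{A}^*(\lambda)I_{n,k}$$ is the dual variable of the constraint $X_{1:k,1:k}=I_k$. Consequently, $(R,y)$ is a global minimizer of (SDPR).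
   Context: Notation: $\mathbb{S}^n$ is the space of real symmetric $n\times n$ matrices with inner product $\langle A,B\rangle=\mathrm{Tr}(AB^\top)$; $\mathbb{S}^n_+$ is the positive semidefinite cone; $\circ$ is the entrywise product; $[A;B]$ stacks $A$ above $B$. Integers $n,m,p,k$ with $0\le k\le n$ are fixed. Data: $\phi:\mathbb{S}^n\times\mathbb{R}^p\to\mathbb{R}$ is convex and continuously differentiable, $b\in\mathbb{R}^m$, and $\mathcal{K}(X,x)=\mathcal{A}(X)+Bx$ with $B\in\mathbb{R}^{m\times p}$ and $\mathcal{A}(X)=(\langle A_1,X\rangle,\dots,\langle A_m,X\rangle)^\top$ for given $A_i\in\mathbb{S}^n$; $\mathcal{A}^*(\lambda)=\sum_i\lambda_iA_i$. (SDP): minimize $\phi(X,x)$ subject to $\mathcal{K}(X,x)=b$, $X_{1:k,1:k}=I_k$, $X\in\mathbb{S}^n_+$, $x\in\mathbb{R}^p_+$. (SDPR) with rank parameter $r$ ($k\le r\le n$): minimize $\phi(\widehat R\widehat R^\top,y\circ y)$ over $(R,y)\in\mathbb{R}^{(n-k)\times r}\times\mathbb{R}^p$ subject to $\mathcal{K}(\widehat R\widehat R^\top,y\circ y)=b$, where $\widehat R=[I_{k,r};R]\in\mathbb{R}^{n\times r}$. $I_{k,r}=[I_k,0_{k\times(r-k)}]$, $I_{n,k}=[I_k;0_{(n-k)\times k}]\in\mathbb{R}^{n\times k}$, $J_{n-k,n}=[0_{(n-k)\times k},I_{n-k}]\in\mathbb{R}^{(n-k)\times n}$. $C$ is partitioned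 as $C=\begin{pmatrix}C_{11}&C_{12}\\C_{21}&C_{22}\end{pmatrix}$ with $C_{11}\in\mathbb{S}^k$, $C_{22}\in\mathbb{S}^{n-k}$. $\tilde{\mathcal{A}}:\mathbb{S}^{n-k}\to\mathbb{R}^m$ is $\tilde{\mathcal{A}}(X)=\mathcal{A}(J_{n-k,n}^\top XJ_{n-k,n})$, with adjoint $\tilde{\mathcal{A}}^*(\lambda)=J_{n-k,n}\mathcal{A}^*(\lambda)J_{n-k,n}^\top$. KKT solution of (SDP): $(X,x,\lambda,\Lambda)$, with $\lambda\in\mathbb{R}^m$ the multiplier of $\mathcal{K}(X,x)=b$ and $\Lambda\in\mathbb{S}^k$ the multiplier of $X_{1:k,1:k}=I_k$, such that $(X,x)$ is feasible for (SDP) and, with $\mathbf{S}:=\nabla_X\phi(X,x)-\mathcal{A}^*(\lambda)-I_{n,k}\Lambda I_{n,k}^\top$ and $\mathbf{s}:=\nabla_x\phi(X,x)-B^\top\lambda$, one has $\mathbf{S}\in\mathbb{S}^n_+$, $\mathbf{s}\in\mathbb{R}^p_+$, $\langle\mathbf{S},X\rangle=0$ and $\langle\mathbf{s},x\rangle=0$. *)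

(* Defs.v *)
From HB Require Import structures.
From mathcomp Require Import all_boot all_order all_algebra.
From mathcomp Require Import all_classical all_reals all_analysis.

Set Implicit Arguments.
Unset Strict Implicit.
Unset Printing Implicit Defensive.

Import Order.TTheory GRing.Theory Num.Theory.
Import numFieldNormedType.Exports.

Local Open Scope classical_set_scope.
Local Open Scope ring_scope.

Lemma symmetricmxE (R : fieldType) n (A : 'M[R]_n) :
  (A \is symmetricmx) = (A == A^T).
Proof. by rewrite qualifE /= expr0 scale1r map_mx_id. Qed.

Lemma symmetricmxP (R : fieldType) n (A : 'M[R]_n) :
  reflect (A^T = A) (A \is symmetricmx).
Proof. by rewrite symmetricmxE eq_sym; exact: eqP. Qed.

Section SymType.
Variables (R : realType) (n : nat).

Definition symset : {pred 'M[R]_n} := fun A => A \is symmetricmx.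

Fact symset_submod_closed : submod_closed symset.
Proof.
split=> [|a A B /symmetricmxP sA /symmetricmxP sB]; apply/symmetricmxP.
  by rewrite trmx0.
by rewrite linearP /= sA sB.
Qed.
HB.instance Definition _ :=
  GRing.isSubmodClosed.Build R 'M[R]_n symset symset_submod_closed.

Record sym := Sym { symval :> 'M[R]_n; symvalP : symval \in symset }.
HB.instance Definition _ := [isSub for symval].
HB.instance Definition _ := [Choice of sym by <:].
HB.instance Definition _ := [SubChoice_isSubLmodule of sym by <:].

Lemma symvalD (A B : sym) : symval (A + B) = symval A + symval B.
Proof. exact: (raddfD (val : sym -> 'M[R]_n)). Qed.
Lemma symvalZ a (A : sym) : symval (a *: A) = a *: symval A.
Proof. by []. Qed.
Lemma symval0 : symval 0 = 0.
Proof. exact: (raddf0 (val : sym -> 'M[R]_n)). Qed.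

(* The entrywise maximum norm; all norms on S^n are equivalent, so neither
   differentiability nor continuity depends on this choice. *)
Definition sym_norm (A : sym) : R := `|symval A|.
Fact sym_normD A B : sym_norm (A + B) <= sym_norm A + sym_norm B.
Proof. by rewrite /sym_norm symvalD; exact: ler_normD. Qed.
Fact sym_normZ a A : sym_norm (a *: A) = `|a| * sym_norm A.
Proof. by rewrite /sym_norm symvalZ; exact: normrZ. Qed.
Fact sym_norm0_eq0 A : sym_norm A = 0 -> A = 0.
Proof.
by move=> /normr0_eq0 A0; apply: val_inj; apply: etrans A0 (esym symval0).
Qed.
HB.instance Definition _ :=
  Lmodule_isNormed.Build R sym sym_normD sym_normZ sym_norm0_eq0.
End SymType.

Lemma symval_sum (R : realType) n I (s : seq I) (P : pred I)
    (F : I -> sym R n) :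
  symval (\sum_(i <- s | P i) F i) = \sum_(i <- s | P i) symval (F i).
Proof. exact: (big_morph _ (@symvalD R n) (@symval0 R n)). Qed.

Definition mxdot (R : realType) m n (A B : 'M[R]_(m, n)) : R := \tr (A *m B^T).

Lemma mxdotE (R : realType) a b (A B : 'M[R]_(a, b)) :
  mxdot A B = \sum_i \sum_j A i j * B i j.
Proof.
rewrite /mxdot /mxtrace; apply: eq_bigr => i _; rewrite mxE.
by apply: eq_bigr => j _; rewrite mxE.
Qed.

Definition hadamard (R : realType) m n (A B : 'M[R]_(m, n)) : 'M[R]_(m, n) :=
  map2_mx *%R A B.

Definition psd (R : realType) n (A : 'M[R]_n) : Prop :=
  A \is symmetricmx /\ forall v : 'cV[R]_n, 0 <= (v^T *m A *m v) 0 0.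

Definition nonneg (R : realType) p (x : 'cV[R]_p) : Prop :=
  forall i, 0 <= x i 0.

Fact gram_subproof (R : realType) n r (M : 'M[R]_(n, r)) :
  M *m M^T \in @symset R n.
Proof. by apply/symmetricmxP; rewrite trmx_mul trmxK. Qed.
Definition gram (R : realType) n r (M : 'M[R]_(n, r)) : sym R n :=
  Sym (gram_subproof M).

Fact congr_sym_subproof (R : realType) a n (P : 'M[R]_(a, n)) (X : sym R n) :
  P *m X *m P^T \in @symset R a.
Proof.
apply/symmetricmxP; have /symmetricmxP sX := symvalP X.
by rewrite !trmx_mul trmxK sX mulmxA.
Qed.
Definition congr_sym (R : realType) a n (P : 'M[R]_(a, n)) (X : sym R n) :
  sym R a := Sym (congr_sym_subproof P X).

Section Gradient.
Variables (R : realType) (n p : nat).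
Implicit Types (phi : sym R n * 'cV[R]_p -> R) (z : sym R n * 'cV[R]_p).

(* The total gradient is the Riesz representative of the Fréchet derivative
   for the inner product <G, H> + <g, h> of S^n x R^p (see gradP); it is 0 where
   phi is not differentiable. *)
Definition is_grad phi z (G : sym R n * 'cV[R]_p) : Prop :=
  forall H : sym R n, forall h : 'cV[R]_p,
    'd phi z (H, h) = mxdot G.1 H + mxdot G.2 h.
Definition grad phi z : sym R n * 'cV[R]_p := get (is_grad phi z).
Definition gradX phi (X : sym R n) (x : 'cV[R]_p) : sym R n :=
  (grad phi (X, x)).1.
Definition gradx phi (X : sym R n) (x : 'cV[R]_p) : 'cV[R]_p :=
  (grad phi (X, x)).2.

Definition continuously_differentiable phi : Prop :=
  (forall z, differentiable phi z) /\ continuous (grad phi).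

Fact symdelta_subproof (i j : 'I_n) :
  2^-1 *: (delta_mx i j + delta_mx j i) \in @symset R n.
Proof.
by apply/symmetricmxP; rewrite linearZ/= linearD/= !trmx_delta addrC.
Qed.
Definition symdelta i j : sym R n := Sym (symdelta_subproof i j).

Lemma symdeltaC i j : symdelta i j = symdelta j i.
Proof. by apply: val_inj; rewrite /= addrC. Qed.

Lemma sym_sum_delta (H : sym R n) :
  H = \sum_i \sum_j symval H i j *: symdelta i j.
Proof.
apply: val_inj; rewrite /= symval_sum.
under eq_bigr do (rewrite symval_sum; under eq_bigr do rewrite symvalZ /=).
apply/matrixP => a b; rewrite summxE.
have /symmetricmxP sH := symvalP H.
have Hba : symval H b a = symval H a b by rewrite -{1}sH mxE.
transitivity (\sum_i \sum_j (symval H i j * (2^-1 * ((a == i) && (b == j))%:R)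
   + symval H i j * (2^-1 * ((a == j) && (b == i))%:R))).
  under eq_bigr do rewrite big_split /=.
  rewrite big_split /= (bigD1 a) //= (bigD1 b) //= !eqxx big1 => [|j /negPf jb].
    rewrite big1 => [|i /negPf ia]; last first.
      by rewrite big1 // => j _; rewrite eq_sym ia !mulr0.
    rewrite (bigD1 b) //= (bigD1 a) //= !eqxx big1 => [|j /negPf ja]; last first.
      by rewrite eq_sym ja !mulr0.
    rewrite big1 => [|i /negPf ib]; last first.
      by rewrite big1 // => j _; rewrite [b == i]eq_sym ib andbF !mulr0.
    by rewrite Hba !addr0 !mulr1 -mulrDr -[2^-1]mul1r -splitr mulr1.
  by rewrite [b == j]eq_sym jb andbF !mulr0.
apply: eq_bigr => i _; rewrite summxE; apply: eq_bigr => j _.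
by rewrite !mxE mulrDr mulrDr.
Qed.

Lemma gradP phi z : is_grad phi z (grad phi z).
Proof.
rewrite /grad; apply: (getPex (P := is_grad phi z)).
have sG : \matrix_(i, j) 'd phi z (symdelta i j, 0) \in @symset R n.
  by apply/symmetricmxP/matrixP => i j; rewrite !mxE symdeltaC.
exists (Sym sG, \col_i 'd phi z (0, delta_mx i 0)) => H h /=.
have -> : (H, h) = (H, 0) + (0, h).
  by apply: injective_projections; rewrite /= ?addr0 ?add0r.
rewrite linearD; congr (_ + _).
  rewrite mxdotE [in LHS](sym_sum_delta H).
  pose L : sym R n -> sym R n * 'cV[R]_p := fun K => (K, 0).
  have LD : {morph L : x y / x + y}.
    by move=> x y; apply: injective_projections; rewrite /= ?addr0.
  have LZ a x : L (a *: x) = a *: L x.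
    by apply: injective_projections; rewrite /= ?scaler0.
  rewrite -/(L _) (big_morph L LD (erefl _)) linear_sum.
  apply: eq_bigr => i _; rewrite (big_morph L LD (erefl _)) linear_sum.
  by apply: eq_bigr => j _; rewrite LZ linearZ /= mxE mulrC.
rewrite mxdotE.
pose L : 'cV[R]_p -> sym R n * 'cV[R]_p := fun K => (0, K).
have LD : {morph L : x y / x + y}.
  by move=> x y; apply: injective_projections; rewrite /= ?addr0.
have LZ a x : L (a *: x) = a *: L x.
  by apply: injective_projections; rewrite /= ?scaler0.
rewrite [in LHS](matrix_sum_delta h) -/(L _) (big_morph L LD (erefl _)).
rewrite linear_sum.
by apply: eq_bigr => i _; rewrite !big_ord1 LZ linearZ /= mxE mulrC.
Qed.
End Gradient.

Section SDP.
(* The matrix order is n = k + l, so that l stands for n - k. *)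
Variables (R : realType) (k l m p : nat).
Variables (phi : sym R (k + l) * 'cV[R]_p -> R).
Variables (Am : 'I_m -> sym R (k + l)) (B : 'M[R]_(m, p)) (b : 'cV[R]_m).

Definition Aop (X : sym R (k + l)) : 'cV[R]_m := \col_i mxdot (Am i) X.
Definition Aadj (lam : 'cV[R]_m) : sym R (k + l) := \sum_i lam i 0 *: Am i.
Definition Kop (X : sym R (k + l)) (x : 'cV[R]_p) : 'cV[R]_m := Aop X + B *m x.

Definition Ink : 'M[R]_(k + l, k) := col_mx 1%:M 0.
Definition Jmx : 'M[R]_(l, k + l) := row_mx 0 1%:M.

Definition tAop (X : sym R l) : 'cV[R]_m := Aop (congr_sym Jmx^T X).
Definition tAadj (lam : 'cV[R]_m) : sym R l := congr_sym Jmx (Aadj lam).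

Lemma AadjP (X : sym R (k + l)) (lam : 'cV[R]_m) :
  mxdot (Aop X) lam = mxdot (symval X) (symval (Aadj lam)).
Proof.
rewrite mxdotE mxdotE symval_sum.
transitivity (\sum_i \sum_a \sum_c
    lam i 0 * (symval (Am i) a c * symval X a c)).
  apply: eq_bigr => i _; rewrite big_ord1 mxE mxdotE mulrC mulr_sumr.
  by apply: eq_bigr => a _; rewrite mulr_sumr.
rewrite exchange_big; apply: eq_bigr => a _ /=.
rewrite exchange_big; apply: eq_bigr => c _ /=.
rewrite summxE mulr_sumr; apply: eq_bigr => i _.
by rewrite mxE mulrA mulrC.
Qed.

Lemma tAadjP (X : sym R l) (lam : 'cV[R]_m) :
  mxdot (tAop X) lam = mxdot (symval X) (symval (tAadj lam)).
Proof.
rewrite AadjP /mxdot /= !trmx_mul !trmxK.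
by rewrite -!mulmxA mxtrace_mulC !mulmxA.
Qed.

Definition sdp_feasible (X : sym R (k + l)) (x : 'cV[R]_p) : Prop :=
  [/\ Kop X x = b, ulsubmx (X : 'M[R]_(k + l)) = 1%:M, psd X & nonneg x].

Definition is_KKT (X : sym R (k + l)) (x : 'cV[R]_p)
    (lam : 'cV[R]_m) (Lam : 'M[R]_k) : Prop :=
  let S : 'M[R]_(k + l) :=
    symval (gradX phi X x) - symval (Aadj lam) - Ink *m Lam *m Ink^T in
  let s : 'cV[R]_p := gradx phi X x - B^T *m lam in
  [/\ sdp_feasible X x, Lam \is symmetricmx,
      psd S /\ nonneg s, mxdot S X = 0 & mxdot s x = 0].

Section SDPR.
Variable r : nat.

(* For k <= r, pid_mx k : 'M_(k, r) is [I_k, 0]. *)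
Definition hatmx (M : 'M[R]_(l, r)) : 'M[R]_(k + l, r) := col_mx (pid_mx k) M.

Definition sdpr_obj (M : 'M[R]_(l, r)) (y : 'cV[R]_p) : R :=
  phi (gram (hatmx M), hadamard y y).
Definition sdpr_feasible (M : 'M[R]_(l, r)) (y : 'cV[R]_p) : Prop :=
  Kop (gram (hatmx M)) (hadamard y y) = b.
Definition sdpr_global_minimizer (M : 'M[R]_(l, r)) (y : 'cV[R]_p) : Prop :=
  sdpr_feasible M y /\
  forall M' y', sdpr_feasible M' y' -> sdpr_obj M y <= sdpr_obj M' y'.
End SDPR.
End SDP.

(* Main.v *)
Require Import Defs.
From HB Require Import structures.
From mathcomp Require Import all_boot all_order all_algebra.
From mathcomp Require Import all_classical all_reals all_analysis.

Set Implicit Arguments.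
Unset Strict Implicit.
Unset Printing Implicit Defensive.

Import Order.TTheory GRing.Theory Num.Theory.
Import numFieldNormedType.Exports.

Local Open Scope classical_set_scope.
Local Open Scope ring_scope.

(** Write D = C - A^*(lambda), P = I_{k,r} and N = [- M P^T, I].  The
    stationarity of M reads D21 P + D22 M = 0; multiplying on the right by P^T,
    and using P P^T = I, gives D21 = - D22 M P^T, that is D22 N = [D21, D22].
    The off-diagonal blocks of D are thus determined by D22, and Lambda is
    exactly the correction of the top left block for which the dual slack
    matrix becomes the congruence N^T D22 N (slack_eq_congr).  Positive
    semidefiniteness of the slack then comes from that of D22, and
    complementarity from the slack being N^T [D21, D22], whose last factor
    kills Mhat = [P; M] by stationarity; the remaining KKT conditions are immediate.

    Global optimality is weak duality for a convex objective (KKT_le_gram):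
    phi lies above its tangent at (X, x) (convex_diff_le), and the derivative
    of phi towards a feasible point (X', x') equals <S, X'> + <s, x'>, because
    the equality constraints absorb the multiplier terms and complementarity
    the terms at (X, x).  Every feasible point of the factorized problem yields
    a feasible point of the SDP whose matrix is a Gram matrix.  Hence the bound
    is only needed at Gram matrices, where <S, X'> >= 0 needs no factorization
    theorem for semidefinite matrices. *)

(** A convex function lies above its tangents: for 0 < t <= 1 convexity bounds
    the difference quotient along w - z by f w - f z, and the bound passes to
    the limit t -> 0+. *)
Lemma convex_diff_le (R : realType) (V : normedModType R) (f : V -> R)
    (z w : V) :
  @convex_function R V setT f -> differentiable f z ->
  'd f z (w - z) <= f w - f z.
Proof.
move=> cf df; rewrite -deriveE // /derive.
set q := (fun h : R => _).
have cq : q h @[h --> 0^'] --> lim (q h @[h --> 0^']).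
  exact: (diff_derivable df).
have cr : q h @[h --> 0^'+] --> lim (q h @[h --> 0^']).
  exact: cvg_dnbhs_at_right.
apply: (cvgr_to_le cr).
near=> t.
have t0 : 0 < t by [].
have t1 : t <= 1 by near: t; apply: nbhs_right_le.
pose s : {i01 R} := Itv01 (ltW t0) t1.
have := cf s w z; rewrite !inE => /(_ I I).
rewrite convRE /=.
have -> : (conv s (w : convex_lmodType V) z : V) = t *: (w - z) + z.
  by rewrite /conv /= scalerBl scalerBr scale1r addrA addrAC.
move=> le_t.
rewrite /q /= ler_pdivrMl // mulrBr lerBlDr.
by apply: le_trans le_t _; rewrite /= mulrBl mul1r addrA addrAC.
Unshelve. all: by end_near.
Qed.

Section Psd.
Variable R : realType.

Lemma mxdotDl m n (A B C : 'M[R]_(m, n)) :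
  mxdot (A + B) C = mxdot A C + mxdot B C.
Proof. by rewrite /mxdot mulmxDl mxtraceD. Qed.

Lemma mxdotNl m n (A C : 'M[R]_(m, n)) : mxdot (- A) C = - mxdot A C.
Proof. by rewrite /mxdot mulNmx linearN. Qed.

Lemma mxdotC m n (A B : 'M[R]_(m, n)) : mxdot A B = mxdot B A.
Proof. by rewrite /mxdot -mxtrace_tr trmx_mul trmxK. Qed.

Lemma mxdotBr m n (A B C : 'M[R]_(m, n)) :
  mxdot A (B - C) = mxdot A B - mxdot A C.
Proof. by rewrite mxdotC mxdotDl mxdotNl !(mxdotC A). Qed.

Lemma mxdot_mull m n q (A : 'M[R]_(m, n)) (B : 'M[R]_(n, q)) C :
  mxdot (A *m B) C = mxdot B (A^T *m C).
Proof. by rewrite /mxdot trmx_mul trmxK -mulmxA mxtrace_mulC mulmxA. Qed.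

Lemma psd_congr n a (A : 'M[R]_n) (N : 'M[R]_(n, a)) :
  psd A -> psd (N^T *m A *m N).
Proof.
move=> [/symmetricmxP sA A_ge0]; split.
  by apply/symmetricmxP; rewrite !trmx_mul trmxK sA mulmxA.
by move=> v; have := A_ge0 (N *m v); rewrite trmx_mul !mulmxA.
Qed.

Lemma psd_gram n r (N : 'M[R]_(n, r)) : psd (gram N : 'M[R]_n).
Proof.
split; first exact: (symvalP (gram N)).
move=> v; rewrite /= mulmxA -mulmxA -[v^T *m N]trmxK trmx_mul trmxK mxE.
by apply: sumr_ge0 => i _; rewrite mxE -expr2 sqr_ge0.
Qed.

Lemma mxdot_gram n r (A : 'M[R]_n) (N : 'M[R]_(n, r)) :
  mxdot A (gram N) = mxdot (A *m N) N.
Proof. by rewrite /mxdot /= trmx_mul trmxK mulmxA. Qed.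

Lemma mxdot_psd_gram_ge0 n r (A : 'M[R]_n) (N : 'M[R]_(n, r)) :
  psd A -> 0 <= mxdot A (gram N).
Proof.
move=> [_ A_ge0]; rewrite mxdot_gram /mxdot mxtrace_mulC mulmxA.
(* The trace of N^T A N sums the quadratic form of A over the columns of N. *)
apply: sumr_ge0 => j _.
have := A_ge0 (col j N).
by rewrite tr_col -!row_mul colE mulmxA -colE !mxE.
Qed.

Lemma mxdot_nonneg_ge0 p (s x : 'cV[R]_p) :
  nonneg s -> nonneg x -> 0 <= mxdot s x.
Proof.
move=> s0 x0; rewrite mxdotE; apply: sumr_ge0 => i _.
by rewrite big_ord1 mulr_ge0.
Qed.

Lemma nonneg_hadamard p (y : 'cV[R]_p) : nonneg (hadamard y y).
Proof. by move=> i; rewrite mxE -expr2 sqr_ge0. Qed.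

End Psd.

Section SDP.
Variables (R : realType) (k l m p : nat).
Variables (phi : sym R (k + l) * 'cV[R]_p -> R).
Variables (Am : 'I_m -> sym R (k + l)) (B : 'M[R]_(m, p)) (b : 'cV[R]_m).

Lemma Ink_congr (L : 'M[R]_k) :
  Ink R k l *m L *m (Ink R k l)^T = block_mx L 0 0 0.
Proof.
by rewrite /Ink tr_col_mx trmx1 trmx0 mul_col_mx mul_col_row !mulmx1 !mulmx0
  mul1mx !mul0mx.
Qed.

Lemma mxdot_Ink (L : 'M[R]_k) (X : 'M[R]_(k + l)) :
  mxdot (Ink R k l *m L *m (Ink R k l)^T) X = mxdot L (ulsubmx X).
Proof.
rewrite Ink_congr -{1}[X]submxK /mxdot tr_block_mx mulmx_block mxtrace_block.
by rewrite !mul0mx !addr0 mxtrace0 addr0.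
Qed.

Lemma ulsubmx_gram_hatmx r (M : 'M[R]_(l, r)) : (k <= r)%N ->
  ulsubmx (gram (hatmx k M) : 'M[R]_(k + l)) = 1%:M.
Proof.
move=> le_kr.
rewrite /= /hatmx tr_col_mx mul_col_row block_mxKul tr_pid_mx pid_mx_id //.
by rewrite pid_mx_1.
Qed.

(** With P = I_{k,r}, the columns of the transpose [- P M^T; I] span the
    vectors v for which hatmx M ^T v vanishes on the first k coordinates when
    k <= r; the slack matrix of the SDP is carried by this subspace. *)
Definition slack_factor r (M : 'M[R]_(l, r)) : 'M[R]_(l, k + l) :=
  row_mx (- (M *m (pid_mx k)^T)) 1%:M.

Lemma ulsubmxB (A D : 'M[R]_(k + l)) :
  ulsubmx (A - D) = ulsubmx A - ulsubmx D.
Proof. by apply/matrixP => i j; rewrite !mxE. Qed.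

Lemma drsubmxB (A D : 'M[R]_(k + l)) :
  drsubmx (A - D) = drsubmx A - drsubmx D.
Proof. by apply/matrixP => i j; rewrite !mxE. Qed.

Lemma Jmx_mull (D : 'M[R]_(k + l)) :
  Jmx R k l *m D = row_mx (dlsubmx D) (drsubmx D).
Proof. by rewrite -{1}(submxK D) /Jmx mul_row_block !mul0mx !mul1mx !add0r. Qed.

Lemma Jmx_congr (D : 'M[R]_(k + l)) :
  Jmx R k l *m D *m (Jmx R k l)^T = drsubmx D.
Proof.
by rewrite Jmx_mull tr_row_mx trmx0 trmx1 mul_row_col mulmx0 add0r mulmx1.
Qed.

Lemma trInk_congr (D : 'M[R]_(k + l)) :
  (Ink R k l)^T *m D *m Ink R k l = ulsubmx D.
Proof.
rewrite -{1}(submxK D) /Ink tr_col_mx trmx0 trmx1 mul_row_block.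
by rewrite !mul0mx !mul1mx !addr0 mul_row_col mulmx0 addr0 mulmx1.
Qed.

(** The stationarity condition in solved form: cancelling P through P P^T = I
    expresses D21 by D22. *)
Lemma drsubmx_slack_factor r (D : 'M[R]_(k + l)) (M : 'M[R]_(l, r)) :
  (k <= r)%N -> Jmx R k l *m D *m hatmx k M = 0 ->
  drsubmx D *m slack_factor M = Jmx R k l *m D.
Proof.
move=> le_kr; rewrite Jmx_mull /hatmx mul_row_col => stat.
have := congr1 (fun A => A *m (pid_mx k : 'M[R]_(k, r))^T) stat.
rewrite /= mulmxDl mul0mx -!mulmxA tr_pid_mx pid_mx_id // pid_mx_1 mulmx1.
move=> /eqP; rewrite addr_eq0 => /eqP ->.
by rewrite /slack_factor mul_mx_row mulmx1 mulmxN tr_pid_mx.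
Qed.

(** By stationarity and symmetry, N^T D22 N and D agree outside the top left
    block, where they differ exactly by Lambda, written here in terms of D; the
    left-hand side is thus the dual slack matrix of the SDP. *)
Lemma slack_eq_congr r (D : 'M[R]_(k + l)) (M : 'M[R]_(l, r)) : (k <= r)%N ->
  D \is symmetricmx -> Jmx R k l *m D *m hatmx k M = 0 ->
  D - Ink R k l *m (ulsubmx D + pid_mx k *m M^T *m Jmx R k l *m D *m Ink R k l)
      *m (Ink R k l)^T =
  (slack_factor M)^T *m drsubmx D *m slack_factor M.
Proof.
move=> le_kr /symmetricmxP sD stat.
have Dur : ursubmx D = - (pid_mx k *m M^T) *m drsubmx D.
  have := drsubmx_slack_factor le_kr stat.
  rewrite Jmx_mull /slack_factor mul_mx_row.
  move=> /eq_row_mx[/(congr1 trmx) + _]; rewrite trmx_dlsub sD => <-.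
  by rewrite trmx_mul trmx_drsub sD linearN /= trmx_mul trmxK.
rewrite -[RHS]mulmxA drsubmx_slack_factor // -(mulmxA _ (Jmx R k l)) Jmx_mull.
rewrite Ink_congr /Ink -[_ *m row_mx _ _ *m _]mulmxA mul_row_col mulmx1.
rewrite mulmx0 addr0.
rewrite /slack_factor tr_row_mx trmx1 linearN /= trmx_mul trmxK mul_col_row.
rewrite !mul1mx -Dur -[D in LHS](submxK D) opp_block_mx add_block_mx !oppr0 !addr0.
by rewrite !submxK opprD addrA subrr add0r mulNmx.
Qed.

Lemma sdp_feasible_hatmx r (M : 'M[R]_(l, r)) (y : 'cV[R]_p) : (k <= r)%N ->
  sdpr_feasible Am B b M y ->
  sdp_feasible Am B b (gram (hatmx k M)) (hadamard y y).
Proof.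
move=> le_kr KMy; split=> //; first exact: ulsubmx_gram_hatmx.
- exact: psd_gram.
- exact: nonneg_hadamard.
Qed.

(** Weak duality.  Splitting the gradient into slack and multiplier parts, the
    multiplier of the fixed block contributes nothing as both blocks are the
    identity, and lambda pairs with the difference of two values of K that both
    equal b. *)
Lemma KKT_le_gram (X : sym R (k + l)) (x : 'cV[R]_p) lam Lam r
    (N : 'M[R]_(k + l, r)) x' :
  @convex_function R (sym R (k + l) * 'cV[R]_p)%type setT phi ->
  differentiable phi (X, x) ->
  is_KKT phi Am B b X x lam Lam -> sdp_feasible Am B b (gram N) x' ->
  phi (X, x) <= phi (gram N, x').
Proof.
move=> cphi dphi [[KX X11 _ _] _ [Spsd s0] SX sx] [KX' X'11 _ x'0].
rewrite -subr_ge0.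
apply: le_trans (@convex_diff_le R _ phi (X, x) (gram N, x') cphi dphi).
have -> : (gram N, x') - (X, x) = (gram N - X, x' - x) by [].
rewrite (gradP phi (X, x)) -/(gradX phi X x) -/(gradx phi X x).
set S := _ - _ - _ in Spsd SX; set s := _ - _ in s0 sx.
have CE : symval (gradX phi X x) =
    S + (symval (Aadj Am lam) + Ink R k l *m Lam *m (Ink R k l)^T).
  by rewrite /S [symval (Aadj _ _) + _]addrC addrA !subrK.
have cE : gradx phi X x = s + B^T *m lam by rewrite subrK.
rewrite CE cE; clearbody S s => {CE cE}.
have symB : symval (gram N - X) = symval (gram N) - symval X.
  exact: (raddfB (val : sym R (k + l) -> 'M[R]_(k + l))).
rewrite symB !mxdotDl !mxdotBr mxdot_Ink !mxdot_Ink X11 X'11 subrr addr0.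
rewrite SX sx !subr0 addrACA.
rewrite addr_ge0 //.
  by rewrite addr_ge0 ?mxdot_psd_gram_ge0 ?mxdot_nonneg_ge0.
rewrite !(mxdotC (symval (Aadj _ _))) -!AadjP !mxdot_mull trmxK.
rewrite !(mxdotC lam) addrACA -opprD -!mxdotDl.
by rewrite -/(Kop Am B X x) -/(Kop Am B (gram N) x') KX KX' subrr.
Qed.

End SDP.

Theorem lemma1 (R : realType) (k l m p r : nat)
    (phi : sym R (k + l) * 'cV[R]_p -> R)
    (Am : 'I_m -> sym R (k + l)) (B : 'M[R]_(m, p)) (b : 'cV[R]_m)
    (phi_convex : @convex_function R (sym R (k + l) * 'cV[R]_p)%type setT phi)
    (phi_C1 : continuously_differentiable phi)
    (le_kr : (k <= r)%N) (le_rn : (r <= k + l)%N)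
    (M : 'M[R]_(l, r)) (y : 'cV[R]_p) (lam : 'cV[R]_m) :
  let Mhat := hatmx k M in
  let X := gram Mhat in
  let x := hadamard y y in
  let C : 'M[R]_(k + l) := symval (gradX phi X x) in
  let c : 'cV[R]_p := gradx phi X x in
  let D : 'M[R]_(k + l) := C - symval (Aadj Am lam) in
  let Lam : 'M[R]_k :=
    ulsubmx C + pid_mx k *m M^T *m Jmx R k l *m D *m Ink R k l
    - (Ink R k l)^T *m symval (Aadj Am lam) *m Ink R k l in
  Kop Am B X x = b ->
  Jmx R k l *m D *m Mhat = 0 ->
  hadamard (c - B^T *m lam) y = 0 ->
  psd (drsubmx C - symval (tAadj Am lam)) ->
  nonneg (c - B^T *m lam) ->
  is_KKT phi Am B b X x lam Lam /\ sdpr_global_minimizer phi Am B b M y.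
Proof.
move=> Mhat X x C c D Lam KXb stat compl slack_psd s0.
have sD : D \is symmetricmx.
  exact: (@rpredB _ (@symset R (k + l)) _ _ (symvalP _) (symvalP _)).
have psd_D : psd (drsubmx D).
  by rewrite /D drsubmxB -[drsubmx (symval (Aadj _ _))]Jmx_congr.
have LamE : Lam = ulsubmx D + pid_mx k *m M^T *m Jmx R k l *m D *m Ink R k l.
  by rewrite /Lam trInk_congr addrAC /D ulsubmxB.
have SE : D - Ink R k l *m Lam *m (Ink R k l)^T =
    (slack_factor k M)^T *m drsubmx D *m slack_factor k M.
  by rewrite LamE slack_eq_congr.
have psd_S : psd (D - Ink R k l *m Lam *m (Ink R k l)^T).
  by rewrite SE; apply: psd_congr.
have KKT : is_KKT phi Am B b X x lam Lam.
  split=> //; first exact: sdp_feasible_hatmx.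
  - have /symmetricmxP sS := psd_S.1.
    apply/symmetricmxP.
    (* Lambda is the top left block of D minus the symmetric slack. *)
    have -> : Lam = ulsubmx (D - (D - Ink R k l *m Lam *m (Ink R k l)^T)).
      by rewrite subKr Ink_congr block_mxKul.
    by rewrite trmx_ulsub linearB /= sS (symmetricmxP _ sD).
  - rewrite -/C -/D SE mxdot_gram -[_ *m _ *m slack_factor k M]mulmxA.
    rewrite drsubmx_slack_factor // -mulmxA stat mulmx0.
    by rewrite /mxdot mul0mx mxtrace0.
  - rewrite mxdotE; apply: big1 => i _; rewrite big_ord1.
    have /matrixP/(_ i 0) := compl.
    by rewrite /x !mxE mulrA => ->; rewrite mul0r.
split=> //; split=> // M' y' feas'.
apply: (KKT_le_gram phi_convex _ KKT (sdp_feasible_hatmx le_kr feas')).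
exact: phi_C1.1.
Qed.
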